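(* Let $R$ be a von Neumann regular ring and let $Q=Q^r_{max}(R)$ be its right maximal quotient ring. The following conditions are equivalent: (1) The ring $R$ is unit regular. (2) The ring $R$ is perspective. (3) For all isomorphic idempotents $e,f\in R$, there exists a right ideal $I$ of $R$ such that $eR\cap I=0=fR\cap I$ and $eR\oplus I=fR\oplus I$ is an essential right ideal of $R$. (4) For all isomorphic idempotents $e,f\in R$, there exists an idempotent $g=g^2\in Q$ such that $eR\cap (gQ\cap R)=0=fR\cap (gQ\cap R)$ and $eR\oplus (gQ\cap R)=fR\oplus (gQ\cap R)$ is an essential right ideal of $R$.
   Context: Rings are associative with identity. A ring $R$ is (von Neumann) regular if for every $a\in R$ there exists $b\in R$ with $a=aba$; it is unit regular if for every $a\in R$ there exists a unit $u\in R$ with $a=aua$. Two idempotents $e,f\in R$ are isomorphic if $eR\cong fR$ as right $R$-modules. A ring $R$ is perspective if for any two idempotents $e,f\in R$ such that $eR\cong fR$ there exists an idempotent $g\in R$ such that $eR\oplus gR=R=fR\oplus gR$ (internal direct sums). The right maximal quotient ring $Q^r_{max}(R)$ of a regular ring $R$ is the maximal right ring of quotients of $R$; it contains $R$ as a subring, it is regular and right self-injective, and as a right $R$-module it is an injective hull of $R_R$. *)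

(* Defs.v *)
From HB Require Import structures.
From mathcomp Require Import all_boot all_order all_algebra.
From mathcomp Require Import boolp classical_sets functions.

Set Implicit Arguments.
Unset Strict Implicit.
Unset Printing Implicit Defensive.

Import GRing.Theory.
Local Open Scope classical_set_scope.
Local Open Scope ring_scope.

(* Rings are [pzRingType]s, so that the zero ring is allowed.  Since
   [GRing.unit] is only available on the nonzero rings of [unitRingType], units
   are described by two-sided inverses. *)

Definition unit_elt (R : pzRingType) (u : R) : Prop :=
  exists v : R, u * v = 1 /\ v * u = 1.

Definition vn_regular (R : pzRingType) : Prop :=
  forall a : R, exists b : R, a = a * b * a.

Definition unit_regular (R : pzRingType) : Prop :=
  forall a : R, exists u : R, unit_elt u /\ a = a * u * a.

Definition right_ideal (R : pzRingType) (I : set R) : Prop :=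
  [/\ I 0, (forall x y, I x -> I y -> I (x - y)) &
      (forall x r, I x -> I (x * r))].

Definition rprinc (R : pzRingType) (a : R) : set R := range (fun r : R => a * r).

Definition sum_set (R : pzRingType) (A B : set R) : set R :=
  [set a + b | a in A & b in B].

Definition is_dsum (R : pzRingType) (A B C : set R) : Prop :=
  A `&` B = [set 0] /\ sum_set A B = C.

Definition essential_right_ideal (R : pzRingType) (J : set R) : Prop :=
  right_ideal J /\
  forall K : set R, right_ideal K -> J `&` K = [set 0] -> K = [set 0].

(* Isomorphism of A and B as right R-modules.  The isomorphism is the
   restriction to A of a function phi that is arbitrary outside A. *)
Definition right_iso (R : pzRingType) (A B : set R) : Prop :=
  exists phi : R -> R,
    [/\ set_bij A B phi,
        (forall x y, A x -> A y -> phi (x + y) = phi x + phi y) &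
        (forall x r, A x -> phi (x * r) = phi x * r)].

Definition idem (R : pzRingType) (e : R) : Prop := e * e = e.

Definition iso_idem (R : pzRingType) (e f : R) : Prop :=
  [/\ idem e, idem f & right_iso (rprinc e) (rprinc f)].

Definition perspective (R : pzRingType) : Prop :=
  forall e f : R, iso_idem e f ->
  exists g : R, [/\ idem g, is_dsum (rprinc e) (rprinc g) setT &
                    is_dsum (rprinc f) (rprinc g) setT].

(* S is a (general) right ring of quotients of R: R embeds in S as a dense
   (rational) right R-submodule. *)
Definition right_quotient_ring (R S : pzRingType) (j : {rmorphism R -> S})
    : Prop :=
  injective j /\
  forall x y : S, x != 0 ->
    exists r : R, x * j r != 0 /\ range j (y * j r).

(* Q is the maximal right ring of quotients of R: every right ring of
   quotients of R embeds in Q over R.  This determines Q up to a unique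
   isomorphism over R. *)
Definition max_right_quotient_ring (R Q : pzRingType)
    (iota : {rmorphism R -> Q}) : Prop :=
  right_quotient_ring iota /\
  forall (S : pzRingType) (j : {rmorphism R -> S}), right_quotient_ring j ->
    exists h : {rmorphism S -> Q}, injective h /\ forall r, h (j r) = iota r.

Definition essential_complement (R : pzRingType) (e f : R) (I : set R) : Prop :=
  [/\ rprinc e `&` I = [set 0],
      rprinc f `&` I = [set 0],
      sum_set (rprinc e) I = sum_set (rprinc f) I &
      essential_right_ideal (sum_set (rprinc e) I)].

(* Main.v *)
Require Import Defs.
From HB Require Import structures.
From mathcomp Require Import all_boot all_order all_algebra.
From mathcomp Require Import boolp classical_sets functions.

Set Implicit Arguments.
Unset Strict Implicit.
Unset Printing Implicit Defensive.

Import GRing.Theory.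
Local Open Scope classical_set_scope.
Local Open Scope ring_scope.

(** Condition (3) already implies perspectivity without any appeal to
    essentiality: if [eR + I = fR + I] then [e = f s + i] and [f = e t + j] with
    [i, j] in [I], so [I] may be replaced by [iR + jR], which is generated by
    an idempotent because R is regular; the complement of the finitely generated
    right ideal [eR + iR + jR] can then be added to it.  Conversely a common
    complement [gR] with [g] in R
    satisfies [gQ ∩ R = gR], which gives (4).

    The equivalence of unit regularity and perspectivity goes through
    complements: perspective idempotents have isomorphic complements, which
    extends a quasi-inverse of [a] to a unit.  In the other direction, unit
    regular rings have isomorphic complements for isomorphic idempotents and
    have stable range one, and stable range one corrects the complement
    [(1 - e)R] of [eR] to one that is also a complement of [fR]. *)

(** * Principal right ideals, projections and isomorphic idempotents *)

Lemma rprinc_id (R : pzRingType) (a : R) : rprinc a a.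
Proof. by exists 1; rewrite ?mulr1. Qed.

Lemma setI_set0P (R : pzRingType) (A B : set R) :
  A 0 -> B 0 -> (forall x, A x -> B x -> x = 0) -> A `&` B = [set 0].
Proof.
by move=> A0 B0 AB; apply/seteqP; split=> [x [/AB]|_ ->] //; apply.
Qed.

Lemma rprinc_right_ideal (R : pzRingType) (a : R) : right_ideal (rprinc a).
Proof.
split=> [|_ _ [r _ <-] [s _ <-]|_ s [r _ <-]].
- by exists 0; rewrite ?mulr0.
- by exists (r - s); rewrite ?mulrBr.
- by exists (r * s); rewrite ?mulrA.
Qed.

Lemma preimage_rprinc_right_ideal (R Q : pzRingType)
    (iota : {rmorphism R -> Q}) (g : Q) : right_ideal (iota @^-1` rprinc g).
Proof.
have [g0 gB gM] := rprinc_right_ideal g; split=> [|x y gx gy|x r gx] /=.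
- by rewrite rmorph0.
- by rewrite rmorphB; apply: gB.
- by rewrite rmorphM; apply: gM.
Qed.

(** Membership in [gQ] amounts to being fixed by left multiplication by [g], an equation that can be
    checked in [R]. *)
Lemma preimage_rprinc_idem (R Q : pzRingType) (iota : {rmorphism R -> Q})
    (g : R) : injective iota -> idem g -> iota @^-1` rprinc (iota g) = rprinc g.
Proof.
move=> iota_inj gg; apply/seteqP; split=> [x [q _ gq]|_ [r _ <-]].
  by exists x => //; apply: iota_inj; rewrite rmorphM -gq mulrA -rmorphM gg.
by exists (iota r); rewrite ?rmorphM.
Qed.

(* [p] is the projection onto [eR] along [gR]. *)
Lemma is_dsum_projection (R : pzRingType) (e g p : R) :
  e * p = p -> p * e = e -> g * (1 - p) = 1 - p -> p * g = 0 ->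
  is_dsum (rprinc e) (rprinc g) setT.
Proof.
move=> ep pe gp pg; split.
  apply: setI_set0P; rewrite /rprinc /=; [by exists 0; rewrite ?mulr0..|].
  by move=> _ [r _ <-] [s _ gs]; rewrite -pe -mulrA -gs mulrA pg mul0r.
apply/seteqP; split=> // x _; exists (e * (p * x)); first by exists (p * x).
exists (g * ((1 - p) * x)); first by exists ((1 - p) * x).
by rewrite !mulrA ep gp -mulrDl addrC subrK mul1r.
Qed.

(** Write [1 = e r + g s] and take [p = e r]; both [e - p e] and [p g] lie in [eR] and in [gR],
    hence vanish. *)
Lemma dsum_projection (R : pzRingType) (e g : R) :
  idem e -> idem g -> is_dsum (rprinc e) (rprinc g) setT ->
  exists p, [/\ e * p = p, p * e = e, g * (1 - p) = 1 - p & p * g = 0].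
Proof.
move=> ee gg [eg0 egT].
have dis x : rprinc e x -> rprinc g x -> x = 0.
  by move=> ex gx; have: (rprinc e `&` rprinc g) x by []; rewrite eg0.
have: [set: R] 1 by [].
rewrite -egT => -[_ [r _ <-]] [_ [s _ <-]] ers.
have gsE : g * s = 1 - e * r by rewrite -ers [_ + g * s]addrC addrK.
exists (e * r); split.
- by rewrite mulrA ee.
- apply/esym/eqP; rewrite -subr_eq0; apply/eqP/dis.
    by exists (1 - r * e) => //; rewrite mulrBr mulr1 mulrA.
  by exists (s * e) => //; rewrite mulrA gsE mulrBl mul1r.
- by rewrite -gsE mulrA gg.
- apply: dis; first by exists (r * g) => //; rewrite mulrA.
  exists (1 - s * g) => //.
  by rewrite mulrBr mulr1 mulrA gsE mulrBl mul1r opprB addrC subrK.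
Qed.

(** On [eR] the isomorphism is left multiplication by [q = phi e]; [p] is the preimage of [f] and
    induces its inverse. *)
Lemma iso_idem_factor (R : pzRingType) (e f : R) : iso_idem e f ->
  exists p q, [/\ p * q = e, q * p = f, e * p = p & f * q = q].
Proof.
move=> [ee ff [phi [[phiB phiI phiS] _ phiM]]].
have [_ [s _ <-] phis] := phiS _ (rprinc_id f).
have fphi : f * phi e = phi e.
  by have [r _ <-] := phiB _ (rprinc_id e); rewrite mulrA ff.
have eM r : phi (e * r) = phi e * r by apply: phiM; apply: rprinc_id.
exists (e * s), (phi e); split=> //.
- apply: phiI; rewrite ?inE.
  + by exists (s * phi e); rewrite ?mulrA.
  + exact: rprinc_id.
  + by rewrite phiM ?phis //; exists s.
- by rewrite -eM mulrA ee.
- by rewrite mulrA ee.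
Qed.

Lemma factor_iso_idem (R : pzRingType) (a b : R) :
  a * b * a = a -> b * a * b = b -> iso_idem (a * b) (b * a).
Proof.
move=> aba bab; split; rewrite /idem ?mulrA ?aba ?bab //.
exists ( *%R b); split=> [|x y _ _|x r _]; rewrite ?mulrDr ?mulrA //; split.
- by move=> _ [r _ <-]; exists (b * r); rewrite // !mulrA bab.
- move=> x y; rewrite !inE => -[r _ <-] [s _ <-] brs.
  by move: (congr1 ( *%R a) brs); rewrite !mulrA aba.
- move=> _ [r _ <-]; exists (a * b * (a * r)); first by exists (a * r).
  by rewrite !mulrA bab.
Qed.

(** Here [k] is an idempotent generator of [aR + bR]. Replacing [b] by [b' = (1 - a c) b] does not
    change the sum, and [b' d (1 - a c)] kills [a] and sends [b] to [b']. *)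
Lemma regular_sum_rprinc (R : pzRingType) (a b : R) : vn_regular R ->
  exists k r s, [/\ k = a * r + b * s, k * a = a & k * b = b].
Proof.
move=> regR; have [c ac] := regR a; have [d bd] := regR (b - a * c * b).
set b' := b - a * c * b in bd.
have kE x : (a * c + b' * d * (1 - a * c)) * x =
            a * c * x + b' * d * (x - a * c * x).
  by rewrite mulrDl -[_ * (1 - _) * x]mulrA [(1 - _) * x]mulrBl mul1r.
exists (a * c + b' * d * (1 - a * c)).
exists (c - c * b * d * (1 - a * c)), (d * (1 - a * c)); split.
- by rewrite [a * (c - _)]mulrBr /b' !mulrBl !mulrA -addrA [- _ + _]addrC.
- by rewrite kE -ac subrr mulr0 addr0.
- by rewrite kE -bd addrC subrK.
Qed.

(** * From common complements to perspectivity, and on to unit regularity *)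

Lemma common_complement_perspective (R : pzRingType) (e f : R) (I : set R) :
  vn_regular R -> right_ideal I ->
  rprinc e `&` I = [set 0] -> rprinc f `&` I = [set 0] ->
  sum_set (rprinc e) I = sum_set (rprinc f) I ->
  exists g, [/\ idem g, is_dsum (rprinc e) (rprinc g) setT &
                is_dsum (rprinc f) (rprinc g) setT].
Proof.
move=> regR [I0 IB IM] eI fI efI.
have ID x y : I x -> I y -> I (x + y).
  by move=> Ix Iy; rewrite -[y]opprK -(sub0r y); apply/IB/IB.
have [s [i Ii eE]] : exists s, exists2 i, I i & f * s + i = e.
  have: sum_set (rprinc e) I e.
    by exists e; [exact: rprinc_id|exists 0; rewrite ?addr0].
  by rewrite efI => -[_ [s _ <-]] [i Ii <-]; exists s, i.
have [t [j Ij fE]] : exists t, exists2 j, I j & e * t + j = f.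
  have: sum_set (rprinc f) I f.
    by exists f; [exact: rprinc_id|exists 0; rewrite ?addr0].
  by rewrite -efI => -[_ [t _ <-]] [j Ij <-]; exists t, j.
(* [h] generates [iR + jR], inside [I]; [k] generates [eR + hR = fR + hR]; [g] generates
   [hR + (1 - k)R]. *)
have [h [r1 [r2 [hE hi hj]]]] := regular_sum_rprinc i j regR.
have hI x : I (h * x) by apply/IM; rewrite hE; apply: ID; apply/IM.
have [k [r3 [r4 [kE ke kh]]]] := regular_sum_rprinc e h regR.
have kf : k * f = f by rewrite -fE mulrDr mulrA ke -hj mulrA kh.
have kfE : k = f * (s * r3) + h * (i * r3 + r4).
  by rewrite kE -{1}eE mulrDl mulrA mulrDr addrA mulrA hi.
have [g [r5 [r6 [gE gh gk]]]] := regular_sum_rprinc h (1 - k) regR.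
have gg : idem g by rewrite /idem {2}gE mulrDr !mulrA gh gk -gE.
have kk : k * k = k by rewrite {2}kE mulrDr !mulrA ke kh -kE.
have dsum c u v : rprinc c `&` I = [set 0] -> k * c = c ->
    k = c * u + h * v -> is_dsum (rprinc c) (rprinc g) setT.
  move=> cI kc kcE; split.
    (* Multiplying [c x = g y] by [k] fixes the left side and kills the [(1 - k)R] part of the right
       side, so [c x] lies in [hR], hence in [I]. *)
    apply: setI_set0P; [by exists 0; rewrite ?mulr0..|] => _ [x _ <-] [y _ gy].
    have: (rprinc c `&` I) (c * x); last by rewrite cI.
    split; first by exists x.
    rewrite -kc -mulrA -gy gE mulrDl mulrDr !mulrA mulrBr mulr1 kk subrr.
    by rewrite !mul0r addr0 kh -mulrA.
  apply/seteqP; split=> // x _; exists (c * (u * x)); first by exists (u * x).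
  exists (g * (h * (v * x) + (1 - k) * x)); first by eexists.
  rewrite mulrDr !mulrA gh gk addrA -mulrDl -kcE -mulrDl.
  by rewrite addrC subrK mul1r.
by exists g; split=> //; [apply: dsum kE|apply: dsum kfE].
Qed.

Lemma perspective_unit_regular (R : pzRingType) :
  vn_regular R -> perspective R -> unit_regular R.
Proof.
move=> regR perR a; have [b0 ab0] := regR a; pose b := b0 * a * b0.
have aba : a * b * a = a by rewrite /b !mulrA -!ab0.
have b0aba : b0 * a * b0 * a = b0 * a by rewrite -!mulrA [a * _]mulrA -ab0.
have bab : b * a * b = b by rewrite /b !mulrA !b0aba.
have [g [gg eg fg]] := perR _ _ (factor_iso_idem aba bab).
have ee : idem (a * b) by rewrite /idem mulrA aba.
have ff : idem (b * a) by rewrite /idem mulrA bab.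
have [e1 [ee1 e1e ge1 e1g]] := dsum_projection ee gg eg.
have [f1 [ff1 f1f gf1 f1g]] := dsum_projection ff gg fg.
set e := a * b in ee ee1 e1e; set f := b * a in ff ff1 f1f.
have comp (p q : R) : g * (1 - p) = 1 - p -> q * g = 0 ->
    (1 - q) * (1 - p) = 1 - p.
  by move=> gp qg; rewrite mulrBl mul1r -{2}gp mulrA qg mul0r subr0.
have inv (c d c1 d1 : R) : c * c1 = c1 -> d1 * d = d ->
    (1 - d1) * (1 - c1) = 1 - c1 ->
    (1 - c) * (1 - d1) * ((1 - d) * (1 - c1)) = 1 - c.
  move=> cc1 d1d dc; rewrite mulrA -[_ * _ * (1 - d)]mulrA.
  rewrite [(1 - d1) * (1 - d)]mulrBr mulr1 [(1 - d1) * d]mulrBl mul1r d1d.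
  by rewrite subrr subr0 -mulrA dc mulrBr mulr1 mulrBl mul1r cc1 subrr subr0.
have xy := inv _ _ _ _ ee1 f1f (comp _ _ ge1 f1g).
have yx := inv _ _ _ _ ff1 e1e (comp _ _ gf1 e1g).
(* [y] maps [(1 - e)R] to [(1 - f)R] through the common complement [gR], and [x] is its inverse.
   Likewise [b] maps [eR] to [fR] with inverse [a], so [b + y] is a unit with inverse [a + x]. *)
set x := (1 - e) * (1 - f1) in xy yx; set y := (1 - f) * (1 - e1) in xy yx.
have bx : b * x = 0.
  by rewrite /x mulrA [b * (1 - _)]mulrBr mulr1 mulrA bab subrr mul0r.
have ay : a * y = 0.
  by rewrite /y mulrA [a * (1 - _)]mulrBr mulr1 mulrA aba subrr mul0r.
have ya : y * a = 0.
  rewrite -aba -/e /y -mulrA [(1 - e1) * _]mulrBl mul1r [e1 * _]mulrA e1e.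
  by rewrite subrr mulr0.
have xb : x * b = 0.
  rewrite -bab -/f /x -mulrA [(1 - f1) * _]mulrBl mul1r [f1 * _]mulrA f1f.
  by rewrite subrr mulr0.
exists (b + y); split; last by rewrite mulrDr mulrDl aba ay mul0r addr0.
exists (a + x); rewrite !mulrDl !mulrDr bx ya ay xb xy yx !addr0 !add0r.
by rewrite ![_ + (1 - _)]addrC !subrK.
Qed.

(** * From unit regularity to perspectivity, through stable range one *)

Lemma unit_regular_stable_range1 (R : pzRingType) (a b c : R) :
  unit_regular R -> a * c + b = 1 -> exists y, unit_elt (a + b * y).
Proof.
move=> /(_ a) [w [[v [wv vw]] awa]] acb.
(* Since [a = e v] and [(1 - e) b = 1 - e], the choice [y = (1 - e) v] gives
   [a + b y = (e + b (1 - e)) v = (1 + n) v], where [n] squares to zero. *)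
pose e := a * w; pose n := e * b * (1 - e).
have ea : e * a = a by rewrite /e -awa.
have ee : e * e = e by rewrite {2}/e mulrA ea.
have eb : (1 - e) * b = 1 - e.
  have -> : b = 1 - a * c by rewrite -acb [_ + b]addrC addrK.
  by rewrite mulrBr mulr1 mulrA mulrBl mul1r ea subrr mul0r subr0.
have bE : b * (1 - e) = n + (1 - e).
  have e1e : (1 - e) * (1 - e) = 1 - e.
    by rewrite mulrBr mulr1 mulrBl mul1r ee subrr subr0.
  rewrite -[X in n + X]e1e -[X in n + X * _]eb -mulrDl -mulrDl.
  by rewrite [e + _]addrC subrK mul1r.
have nn : n * n = 0.
  rewrite /n -!mulrA [(1 - e) * _]mulrA mulrBl mul1r ea subrr.
  by rewrite mul0r !mulr0.
exists ((1 - e) * v).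
have -> : a + b * ((1 - e) * v) = (1 + n) * v.
  have {1}-> : a = e * v by rewrite -mulrA wv mulr1.
  by rewrite mulrA bE -mulrDl addrC -addrA subrK [n + 1]addrC.
exists (w * (1 - n)); split.
  rewrite mulrA -[_ * v * w]mulrA vw mulr1 mulrBr mulr1 mulrDl mul1r nn.
  by rewrite addr0 addrK.
rewrite mulrA -[_ * (1 + n)]mulrA mulrDr mulr1 mulrBl mul1r nn subr0.
by rewrite subrK mulr1.
Qed.

(** The unit [w] carries [mR], a complement of [pR = eR], onto [nR], the right annihilator of [p],
    which is [(1 - f)R]. Since [mR] and [(1 - e)R] both complement [eR], they are isomorphic. *)
Lemma unit_regular_complement_factor (R : pzRingType) (e f : R) :
  unit_regular R -> iso_idem e f ->
  exists x y, [/\ x * y = 1 - e, y * x = 1 - f, (1 - e) * x = x &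
                  x * f = 0].
Proof.
move=> uR ef; have [ee ff _] := ef.
have [p [q [pq qp ep fq]]] := iso_idem_factor ef.
have [w [[v [wv vw]] pwp]] := uR p.
have pf : p * f = p by rewrite -qp mulrA pq ep.
pose m := 1 - p * w; pose n := 1 - w * p.
have wm : w * m = n * w by rewrite /m /n mulrBr mulrBl mulr1 mul1r mulrA.
have me : m * e = 0 by rewrite -pq mulrA mulrBl mul1r -pwp subrr mul0r.
have fn : f * n = 0 by rewrite -qp -mulrA mulrBr mulr1 mulrA -pwp subrr mulr0.
have cc (c : R) : idem c -> (1 - c) * (1 - c) = 1 - c.
  by move=> c2; rewrite mulrBr mulr1 mulrBl mul1r c2 subrr subr0.
exists ((1 - e) * v * (1 - f)), (w * m); split.
- rewrite wm mulrA -[_ * (1 - f) * n]mulrA [(1 - f) * n]mulrBl mul1r fn subr0.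
  rewrite -mulrA -wm mulrA -[_ * v * w]mulrA vw mulr1.
  by rewrite /m mulrBr mulr1 mulrA mulrBl mul1r ep subrr mul0r subr0.
- rewrite mulrA mulrA -[w * m * _]mulrA [m * (1 - e)]mulrBr mulr1 me subr0.
  rewrite wm -[n * w * v]mulrA wv mulr1 /n mulrBl mul1r -mulrA.
  by rewrite [p * _]mulrBr mulr1 pf subrr mulr0 subr0.
- by rewrite !mulrA cc.
- by rewrite -mulrA [(1 - f) * f]mulrBl mul1r ff subrr mulr0.
Qed.

Lemma unit_regular_perspective (R : pzRingType) :
  unit_regular R -> perspective R.
Proof.
move=> uR e f ef; have [ee ff _] := ef.
have [x [y [xy yx ex xf]]] := unit_regular_complement_factor uR ef.
have [e' e'E] : exists e', 1 - e = e' by eexists.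
rewrite e'E in xy ex; have e'De : e' + e = 1 by rewrite -e'E subrK.
have e'e : e' * e = 0 by rewrite -e'E mulrBl mul1r ee subrr.
have ee' : e * e' = 0 by rewrite -e'E mulrBr mulr1 ee subrr.
have e'e' : e' * e' = e' by rewrite -{2}e'E mulrBr mulr1 e'e subr0.
have ex0 : e * x = 0 by rewrite -ex mulrA ee' mul0r.
(* A complement of [eR] of the form [(e' + e y s e')R] also complements [fR] as
   soon as [x e' + (x e y) s e'] is invertible in [e'Re']; adding [e] turns this
   into an instance of stable range one in R itself. *)
have [s [v [uv vu]]] : exists s, unit_elt (x * e' + e + x * e * y * s).
  (* The required identity is [x y = e'] with [y] split as [e' y + e y], plus [e] on both sides. *)
  apply: (unit_regular_stable_range1 (c := e' * y + e)) => //.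
  rewrite mulrDr !mulrDl ee [e * (e' * y)]mulrA ee' mul0r addr0.
  rewrite mulrA -[x * e' * e']mulrA e'e' -[x * e' * e]mulrA e'e mulr0 add0r.
  by rewrite addrAC -mulrDl -mulrDr e'De mulr1 xy e'De.
set u := _ + _ + _ in uv vu.
have eu : e * u = e by rewrite /u !mulrDr !mulrA ex0 !mul0r ee add0r addr0.
have ev : e * v = e by rewrite -{1}eu -mulrA uv mulr1.
(* [w] is the inverse of [x g] in the corner ring [e'Re']. *)
pose g := e' + e * y * s * e'; pose w := e' * v * e'.
have ge' : g * e' = g by rewrite /g mulrDl e'e' -[_ * e' * e']mulrA e'e'.
have e'g : e' * g = e' by rewrite /g mulrDr !mulrA e'e' e'e !mul0r addr0.
have gg : g * g = g by rewrite -{1}ge' -mulrA e'g.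
have xg : x * g = u * e'.
  by rewrite /g /u mulrDr !mulrDl ee' addr0 !mulrA -[x * e' * e']mulrA e'e'.
have e'M c d : c * e' * d = c * d - c * (e * d).
  by rewrite -e'E mulrBr mulr1 mulrBl !mulrA.
have xgw : x * g * w = e'.
  rewrite xg /w !mulrA -[u * e' * e']mulrA e'e' e'M uv ev mulrBl mul1r -mulrA.
  by rewrite ee' mulr0 subr0.
have wxg : w * (x * g) = e'.
  rewrite xg /w mulrA e'M -[e' * v * u]mulrA vu mulr1 eu mulrBl e'e' -mulrA ee'.
  by rewrite mulr0 subr0.
have fixP (c p : R) : (1 - c) * p = 0 -> c * p = p.
  by rewrite mulrBl mul1r => /eqP; rewrite subr_eq0 => /eqP.
exists g; split=> //.
- apply: (is_dsum_projection (p := 1 - g)).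
  + by apply: fixP; rewrite e'E mulrBr mulr1 e'g subrr.
  + by rewrite mulrBl mul1r -ge' -mulrA e'e mulr0 subr0.
  + by rewrite opprB addrC subrK gg.
  + by rewrite mulrBl mul1r gg subrr.
(* [x] has right annihilator [fR] and maps [gR] isomorphically onto [e'R], so [g w x] is the
   projection onto [gR] along [fR]. *)
- apply: (is_dsum_projection (p := 1 - g * w * x)).
  + apply: fixP.
    by rewrite -yx -mulrA mulrBr mulr1 2!(mulrA x) xgw ex subrr mulr0.
  + by rewrite mulrBl mul1r -mulrA xf mulr0 subr0.
  + by rewrite opprB addrC subrK !mulrA gg.
  + by rewrite mulrBl mul1r -(mulrA _ x) -(mulrA g w) wxg ge' subrr.
Qed.

Theorem proposition3p3 (R Q : pzRingType) (iota : {rmorphism R -> Q})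
    (regR : vn_regular R) (maxQ : max_right_quotient_ring iota) :
  [<-> unit_regular R;
       perspective R;
       forall e f : R, iso_idem e f ->
         exists I : set R, right_ideal I /\ essential_complement e f I;
       forall e f : R, iso_idem e f ->
         exists g : Q, idem g /\
           essential_complement e f (iota @^-1` rprinc g)].
Proof.
have [[iota_inj _] _] := maxQ.
have complement e f g : is_dsum (rprinc e) (rprinc g) setT ->
    is_dsum (rprinc f) (rprinc g) setT -> essential_complement e f (rprinc g).
  move=> [eg egT] [fg fgT]; split; rewrite ?egT ?fgT //.
  by split=> [|K _]; [split|rewrite setTI].
have per : (forall e f : R, iso_idem e f ->
    exists I : set R, right_ideal I /\ essential_complement e f I) ->
    perspective R.
  move=> H e f /H[I [idI [eI fI efI _]]].
  exact: common_complement_perspective regR idI eI fI efI.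
tfae.
- exact: unit_regular_perspective.
- move=> perR e f /perR[g [_ eg fg]]; exists (rprinc g).
  by split; [exact: rprinc_right_ideal|exact: complement].
- move=> /per perR e f /perR[g [gg eg fg]]; exists (iota g).
  split; first by rewrite /idem -rmorphM gg.
  by rewrite preimage_rprinc_idem //; apply: complement.
(* Condition (4) is an instance of (3) with [I] equal to [gQ ∩ R], so the cycle closes through
   perspectivity. *)
- move=> H; apply: perspective_unit_regular => //; apply: per.
  move=> e f /H[g [_ efg]].
  by exists (iota @^-1` rprinc g); split=> //; apply: preimage_rprinc_right_ideal.
Qed.
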